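(* Let $A\in\mathbb{R}^{n\times n}$ and $B\in\mathbb{R}^{n\times m}$, and assume that the controllability matrix $\mathcal{R}:=[\,B\;|\;AB\;|\;A^2B\;|\;\cdots\;|\;A^{n-1}B\,]\in\mathbb{R}^{n\times nm}$ of the pair $(A,B)$ has no zero rows. Define $$J:=\{j\in[1,nm]:\mathcal{R}\mathbf{e}_j\text{ is unisigned}\},\qquad \mathcal{H}:=\bigcup_{j\in J}\overline{\mathrm{ZP}}(\mathcal{R}\mathbf{e}_j),$$ and suppose that for every $h\in[1,n]\setminus\mathcal{H}$ there exists $j\in[1,nm]\setminus J$ such that: (i) $[\mathcal{R}]_{hj}\neq 0$; and (ii) for every $k\in[1,n]\setminus\mathcal{H}$, the condition $[\mathcal{R}]_{kj}\neq0$ implies $\mathrm{sign}([\mathcal{R}]_{kj})=\mathrm{sign}([\mathcal{R}]_{hj})$. Then the pair $(A,B)$ is herdable.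
   Context: For integers $k\le n$, $[k,n]$ denotes the integer set $\{k,k+1,\dots,n\}$. $[M]_{ij}$ is the $(i,j)$ entry of $M$, and $\mathbf{e}_j$ is the $j$-th canonical basis vector (of the appropriate dimension), so $M\mathbf{e}_j$ is the $j$-th column of $M$. For a vector $\mathbf{v}\in\mathbb{R}^n$, $\overline{\mathrm{ZP}}(\mathbf{v})=\{i\in[1,n]:[\mathbf{v}]_i\neq 0\}$ is its non-zero pattern. A nonzero vector is unisigned if all its nonzero entries have the same sign (the zero vector is not unisigned). Herdability: the pair $(A,B)$ describes the linear time-invariant system $\dot{\mathbf{x}}(t)=A\mathbf{x}(t)+B\mathbf{u}(t)$ (or its discrete-time counterpart $\mathbf{x}(t+1)=A\mathbf{x}(t)+B\mathbf{u}(t)$). The pair is (completely) herdable if for every $\mathbf{x}(0)$ and every $h>0$ there exist a time $t_f>0$ and an input $\mathbf{u}(t)$, $t\in[0,t_f)$, driving the state from $\mathbf{x}(0)$ to some $\mathbf{x}(t_f)\ge h\mathbf{1}_n$ (entrywise, $\mathbf{1}_n$ the all-ones vector). It is known that (in both continuous and discrete time) this is equivalent to the image (column space) of the controllability matrix $[B\,|\,AB\,|\,\cdots\,|\,A^{n-1}B]$ containing a vector all of whose entries are positive. *)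

(* Defs.v *)
From HB Require Import structures.
From mathcomp Require Import all_boot all_order all_algebra.
From mathcomp Require Import all_classical all_reals all_analysis.

Set Implicit Arguments.
Unset Strict Implicit.
Unset Printing Implicit Defensive.

Import Order.TTheory GRing.Theory Num.Theory.
Import numFieldNormedType.Exports.

Local Open Scope ring_scope.

(* The columns are indexed by 'I_(\sum_(k < n) m), of cardinality n * m; they
   are laid out block by block, [B | A B | ... | A^(n-1) B]. *)
Definition ctrb (R : realType) (n m : nat) (A : 'M[R]_n) (B : 'M[R]_(n, m)) :
  'M[R]_(n, \sum_(k < n) m) := \mxrow_(k < n) (A ^+ k *m B).

Definition nzpattern (R : realType) (n : nat) (v : 'cV[R]_n) : {set 'I_n} :=
  [set i | v i ord0 != 0]%SET.

Definition unisigned (R : realType) (n : nat) (v : 'cV[R]_n) : bool :=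
  (v != 0) &&
  [forall i in nzpattern v, forall j in nzpattern v,
     Num.sg (v i ord0) == Num.sg (v j ord0)].

Definition unisigned_cols (R : realType) (n p : nat) (M : 'M[R]_(n, p)) :
  {set 'I_p} := [set j | unisigned (col j M)]%SET.

Definition unisigned_cover (R : realType) (n p : nat) (M : 'M[R]_(n, p)) :
  {set 'I_n} := (\bigcup_(j in unisigned_cols M) nzpattern (col j M))%SET.

(* Continuous inputs and classical solutions are the most restrictive choice:
   such a pair (u, x) is also a trajectory when inputs are only required to be
   piecewise continuous or locally integrable. *)
Definition ct_trajectory (R : realType) (n m : nat) (A : 'M[R]_n)
    (B : 'M[R]_(n, m)) (tf : R) (u : R -> 'cV[R]_m) (x : R -> 'cV[R]_n) : Prop :=
  [/\ ({within `[0%R, tf[, continuous u})%classic,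
      ({within `[0%R, tf], continuous x})%classic &
      forall t : R, 0 < t < tf -> is_derive t 1 x (A *m x t + B *m u t)].

Definition ct_herdable (R : realType) (n m : nat) (A : 'M[R]_n)
    (B : 'M[R]_(n, m)) : Prop :=
  forall (x0 : 'cV[R]_n) (h : R), 0 < h ->
  exists tf : R, 0 < tf /\
  exists (u : R -> 'cV[R]_m) (x : R -> 'cV[R]_n),
    [/\ ct_trajectory A B tf u x, x 0 = x0 & forall i, h <= x tf i ord0].

Definition dt_trajectory (R : realType) (n m : nat) (A : 'M[R]_n)
    (B : 'M[R]_(n, m)) (tf : nat) (u : nat -> 'cV[R]_m) (x : nat -> 'cV[R]_n) :
    Prop :=
  forall t : nat, (t < tf)%N -> x t.+1 = A *m x t + B *m u t.

Definition dt_herdable (R : realType) (n m : nat) (A : 'M[R]_n)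
    (B : 'M[R]_(n, m)) : Prop :=
  forall (x0 : 'cV[R]_n) (h : R), 0 < h ->
  exists tf : nat, (0 < tf)%N /\
  exists (u : nat -> 'cV[R]_m) (x : nat -> 'cV[R]_n),
    [/\ dt_trajectory A B tf u x, x 0%N = x0 & forall i, h <= x tf i ord0].

(* Main.v *)
Require Import Defs.
From HB Require Import structures.
From mathcomp Require Import all_boot all_order all_algebra.
From mathcomp Require Import all_classical all_reals all_analysis.
From mathcomp Require Import lra.

Set Implicit Arguments.
Unset Strict Implicit.
Unset Printing Implicit Defensive.

Import Order.TTheory GRing.Theory Num.Theory.
Import numFieldNormedType.Exports.
Local Open Scope ring_scope.

(** Both herdability claims reduce to one fact about the controllability matrix
    M: its image contains an entrywise positive vector.

    The positive vector ([image_gt0_of_cover]).  A unisigned column, multiplied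
    by its sign, is nonnegative everywhere and positive on its support; the sum
    of these is a nonnegative vector v0, positive exactly on the covered rows.
    For an uncovered row h, the column given by the hypothesis, multiplied by
    its sign at h, is nonnegative on all the uncovered rows and positive at h;
    the sum of such columns is a vector v1 that is positive on every uncovered
    row but of unknown sign elsewhere.  Then v1 + c v0 is positive everywhere as
    soon as c is large.

    From the positive vector to herdability.  Trajectories superpose: the free
    response to x0 plus c times a forced response from 0 to the positive vector
    exceeds any threshold for c large.  It remains to produce both responses.
    In discrete time this is the explicit solution formula ([dt_stateE]).

    In continuous time the free response is the exponential series of t A
    applied to x0, summed coordinate by coordinate ([free_response]).  The
    forced responses have polynomial inputs and states ([flat_response]):
    look for x = \sum_k p_k A^k B w with scalar polynomials p_k.  Reducing A^n
    by the Cayley-Hamilton theorem, the differential equation becomes a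
    triangular recurrence that expresses every p_k, and then the input, by the
    last one, p_(n-1), and its derivatives: p_(n-1) is a flat output.  Taking
    it to be t^n (t - 1)^j puts x at 0 at time 0 and, at time 1, at a nonzero
    multiple of A^(n-1-j) B w up to lower powers of A.  Hence every A^k B w, and
    so the whole image of the controllability matrix, is reached at time 1
    ([ct_reachable_exp]). *)

(** * A positive combination of the columns *)

Definition coherent_on (R : realDomainType) (n p : nat) (M : 'M[R]_(n, p))
    (S : {set 'I_n}) (j : 'I_p) : bool :=
  [forall i in S, forall k in S, 0 <= M i j * M k j].

Lemma coherent_onP (R : realDomainType) (n p : nat) (M : 'M[R]_(n, p))
    (S : {set 'I_n}) (j : 'I_p) :
  reflect {in S &, forall i k, 0 <= M i j * M k j} (coherent_on M S j).
Proof.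
apply: (iffP 'forall_in_forall_inP) => H i.
  by move=> k iS kS; exact: H.
by move=> iS k kS; exact: H.
Qed.

(** The weight of a coherent column is the sum of its entries over the rows of
    S.  It stands in for the sign of the column, without choosing a row to read
    that sign from: its product with an entry in S is a sum of nonnegative
    terms, among which is the square of the entry. *)
Definition signed_sum (R : realDomainType) (n p : nat) (M : 'M[R]_(n, p))
    (S : {set 'I_n}) : 'cV[R]_p :=
  \col_j (if coherent_on M S j then \sum_(k in S) M k j else 0).

Lemma mul_signed_sumE (R : realDomainType) (n p : nat) (M : 'M[R]_(n, p))
    (S : {set 'I_n}) (i : 'I_n) :
  (M *m signed_sum M S) i ord0 =
  \sum_(j | coherent_on M S j) \sum_(k in S) M i j * M k j.
Proof.
rewrite mxE [RHS]big_mkcond; apply: eq_bigr => j _; rewrite mxE.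
by case: ifP; rewrite ?mulr0 // mulr_sumr.
Qed.

Lemma mul_signed_sum_ge0 (R : realDomainType) (n p : nat) (M : 'M[R]_(n, p))
    (S : {set 'I_n}) (i : 'I_n) :
  i \in S -> 0 <= (M *m signed_sum M S) i ord0.
Proof.
move=> iS; rewrite mul_signed_sumE sumr_ge0 // => j /coherent_onP cj.
by apply: sumr_ge0 => k kS; exact: cj.
Qed.

Lemma mul_signed_sum_gt0 (R : realDomainType) (n p : nat) (M : 'M[R]_(n, p))
    (S : {set 'I_n}) (i : 'I_n) (j : 'I_p) :
  i \in S -> coherent_on M S j -> M i j != 0 ->
  0 < (M *m signed_sum M S) i ord0.
Proof.
move=> iS cj Mij; rewrite mul_signed_sumE (bigD1 j) //= ltr_pwDl //.
  rewrite (bigD1 i) //= ltr_pwDl // -?expr2 ?exprn_even_gt0 //.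
  by apply: sumr_ge0 => k /andP[kS _]; exact: (coherent_onP _ _ _ cj).
apply: sumr_ge0 => l /andP[/coherent_onP cl _].
by apply: sumr_ge0 => k kS; exact: cl.
Qed.

Lemma large_multiple (R : realFieldType) (I : finType) (P : pred I)
    (a b : I -> R) :
  (forall i, P i -> 0 < b i) ->
  exists2 c, 0 <= c & forall i, P i -> 0 < a i + c * b i.
Proof.
move=> b_gt0; exists (\sum_(i | P i) (`|a i| + 1) / b i).
  by apply: sumr_ge0 => i Pi; rewrite divr_ge0 ?addr_ge0 // ltW ?b_gt0.
move=> i Pi; rewrite (bigD1 i) //= mulrDl divfK ?gt_eqF ?b_gt0 //.
have : 0 <= (\sum_(j | P j && (j != i)) (`|a j| + 1) / b j) * b i.
  rewrite mulr_ge0 // ?(ltW (b_gt0 _ Pi)) // sumr_ge0 // => j /andP[Pj _].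
  by rewrite divr_ge0 ?addr_ge0 // ltW ?b_gt0.
have := ler_norm (- a i); rewrite normrN; lra.
Qed.

Lemma sg_eq_mul_ge0 (R : realDomainType) (x y : R) :
  (x != 0 -> y != 0 -> Num.sg x = Num.sg y) -> 0 <= x * y.
Proof.
case: (eqVneq x 0) => [->|x0]; first by rewrite mul0r.
case: (eqVneq y 0) => [->|y0]; first by rewrite mulr0.
move=> /(_ isT isT) sxy; rewrite -sgr_ge0 sgrM sxy -expr2; exact: sqr_ge0.
Qed.

Lemma unisigned_coherent (R : realType) (n p : nat) (M : 'M[R]_(n, p))
    (j : 'I_p) : unisigned (col j M) -> coherent_on M [set: 'I_n]%SET j.
Proof.
case/andP=> _ /'forall_in_forall_inP sgE; apply/coherent_onP => i k _ _.
apply: sg_eq_mul_ge0 => Mi0 Mk0.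
by have := sgE i _ k; rewrite !inE !mxE => /(_ Mi0 Mk0)/eqP.
Qed.

(** The columns coherent on all the rows serve the covered rows, those coherent
    on the uncovered rows serve the latter.  The first combination is
    nonnegative everywhere, so a large multiple of it repairs the second on the
    covered rows without spoiling the uncovered ones. *)
Lemma image_gt0_of_cover (R : realType) (n p : nat) (M : 'M[R]_(n, p)) :
  (forall h : 'I_n, h \notin unisigned_cover M ->
     exists j : 'I_p,
       M h j != 0 /\
       (forall k : 'I_n, k \notin unisigned_cover M -> M k j != 0 ->
          Num.sg (M k j) = Num.sg (M h j))) ->
  exists w : 'cV[R]_p, forall i, 0 < (M *m w) i ord0.
Proof.
move=> Msign; pose H := unisigned_cover M; pose T := [set: 'I_n]%SET.
have wT_gt0 i : i \in H -> 0 < (M *m signed_sum M T) i ord0.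
  case/bigcupP=> j; rewrite !inE mxE => Jj Mij.
  by apply: (mul_signed_sum_gt0 (j := j)); rewrite ?inE ?unisigned_coherent.
have wC_gt0 i : i \notin H -> 0 < (M *m signed_sum M (~: H)) i ord0.
  move=> iH; have [j [Mij sgj]] := Msign i iH.
  apply: (mul_signed_sum_gt0 (j := j)); rewrite ?inE //.
  apply/coherent_onP => k l; rewrite !inE => kH lH.
  by apply: sg_eq_mul_ge0 => Mk Ml; rewrite !sgj.
have [c c_ge0 c_gt0] := large_multiple
  (fun i => (M *m signed_sum M (~: H)) i ord0) wT_gt0.
exists (signed_sum M (~: H) + c *: signed_sum M T) => i.
rewrite mulmxDr -scalemxAr mxE [X in _ + X]mxE.
have [iH|iH] := boolP (i \in H); first exact: c_gt0.
by rewrite ltr_pwDl ?wC_gt0 // mulr_ge0 // mul_signed_sum_ge0 ?inE.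
Qed.

(** * Powers of the state matrix *)

Lemma ctrb_mulE (R : realType) (n m : nat) (A : 'M[R]_n) (B : 'M[R]_(n, m))
    (w : 'cV[R]_(\sum_(k < n) m)) :
  ctrb A B *m w = \sum_(k < n) A ^+ k *m B *m submxcol w k.
Proof. by rewrite -[in LHS](submxcolK w) mul_mxrow_mxcol. Qed.

Lemma exp_combination (R : comNzRingType) (n : nat) (A : 'M[R]_n) :
  exists c : nat -> R, A ^+ n = \sum_(k < n) c k *: A ^+ k.
Proof.
case: n A => [|n] A.
  by exists (fun=> 0); apply/matrixP => -[].
exists (fun k => - (char_poly A)`_k).
have := Cayley_Hamilton A.
have /monicP := char_poly_monic A; rewrite lead_coefE size_char_poly /= => lc.
rewrite /horner_mx /horner_morph horner_coef size_map_poly_id0; last first.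
  by rewrite lead_coefE size_char_poly lc; apply: oner_neq0.
rewrite size_char_poly big_ord_recr /= coef_map lc /= mul1r => /eqP.
rewrite addrC addr_eq0 => /eqP ->; rewrite -sumrN; apply: eq_bigr => k _.
by rewrite coef_map /= scaleNr -mul_scalar_mx.
Qed.

(** * Discrete time *)

Fixpoint dt_state (R : realType) (n m : nat) (A : 'M[R]_n) (B : 'M[R]_(n, m))
    (x0 : 'cV[R]_n) (u : nat -> 'cV[R]_m) (t : nat) : 'cV[R]_n :=
  if t is s.+1 then A *m dt_state A B x0 u s + B *m u s else x0.

Lemma dt_stateE (R : realType) (n m : nat) (A : 'M[R]_n) (B : 'M[R]_(n, m))
    (x0 : 'cV[R]_n) (u : nat -> 'cV[R]_m) (t : nat) :
  dt_state A B x0 u t =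
  A ^+ t *m x0 + \sum_(k < t) A ^+ k *m B *m u (t - k.+1)%N.
Proof.
elim: t => [|t IH] /=; first by rewrite big_ord0 addr0 expr0 mul1mx.
rewrite IH big_ord_recl expr0 mul1mx subn1 mulmxDr mulmxA exprS -addrA.
congr (_ + _); rewrite addrC mulmx_sumr; congr (_ + _).
by apply: eq_bigr => k _; rewrite exprS !mulmxA.
Qed.

Lemma dt_herdable_of_image (R : realType) (n m : nat) (A : 'M[R]_n)
    (B : 'M[R]_(n, m)) (w : 'cV[R]_(\sum_(k < n) m)) :
  (forall i, 0 < (ctrb A B *m w) i ord0) -> dt_herdable A B.
Proof.
move=> w_gt0 x0 h h_gt0.
(* The horizon n + 1, with no input at the first step, rather than n: it stays
   positive when n = 0. *)
exists n.+1; split=> //.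
have [c _ c_gt0] := large_multiple (P := predT)
  (fun i => (A ^+ n.+1 *m x0) i ord0 - h) (fun i _ => w_gt0 i).
pose v k := if insub k is Some i then submxcol w i else 0.
pose u s := c *: v (n - s)%N.
exists u, (dt_state A B x0 u); split=> // i.
have -> : dt_state A B x0 u n.+1 = A ^+ n.+1 *m x0 + c *: (ctrb A B *m w).
  rewrite dt_stateE ctrb_mulE big_ord_recr /= {2}/u subnn subn0 /v.
  rewrite insubF ?ltnn // scaler0 mulmx0 addr0; congr (_ + _).
  rewrite scaler_sumr; apply: eq_bigr => k _.
  rewrite /u /v subSS subKn ?(ltnW (ltn_ord k)) //.
  by rewrite valK scalemxAr.
by have := c_gt0 i isT; rewrite !mxE; lra.
Qed.

(** * Continuous-time responses *)

Lemma is_derive_cV (R : realFieldType) (n : nat) (x : R -> 'cV[R]_n) (t : R)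
    (dx : 'cV[R]_n) :
  (forall i, is_derive t 1 (fun s => x s i ord0) (dx i ord0)) ->
  is_derive t 1 x dx.
Proof.
move=> dxi; have xt : derivable x t 1.
  by apply/derivable_mxP => i j; rewrite [j]ord1; case: (dxi i).
apply: DeriveDef => //; rewrite derive_mx //; apply/matrixP => i j.
by rewrite mxE [j]ord1; case: (dxi i).
Qed.

(** Trajectories on the whole real line rather than on an interval: every
    response below is analytic, and there are no boundary conditions to carry
    through the superposition lemmas. *)
Definition ct_response (R : realType) (n m : nat) (A : 'M[R]_n)
    (B : 'M[R]_(n, m)) (u : R -> 'cV[R]_m) (x : R -> 'cV[R]_n) : Prop :=
  continuous u /\ forall t : R, is_derive t 1 x (A *m x t + B *m u t).

Lemma ct_responseD (R : realType) (n m : nat) (A : 'M[R]_n)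
    (B : 'M[R]_(n, m)) u1 x1 u2 x2 :
  ct_response A B u1 x1 -> ct_response A B u2 x2 ->
  ct_response A B (u1 + u2) (x1 + x2).
Proof.
move=> [u1c dx1] [u2c dx2]; split=> [t|t].
  by apply: cvgD; [exact: u1c|exact: u2c].
apply: (is_derive_eq (is_deriveD (dx1 t) (dx2 t))).
by rewrite !mulmxDr addrACA.
Qed.

Lemma ct_responseZ (R : realType) (n m : nat) (A : 'M[R]_n)
    (B : 'M[R]_(n, m)) (c : R) u x :
  ct_response A B u x -> ct_response A B (c *: u) (c *: x).
Proof.
move=> [uc dx]; split=> [t|t].
  by apply: cvgZl_tmp; exact: uc.
apply: (is_derive_eq (is_deriveZ c (dx t))).
by rewrite -!scalemxAr scalerDr.
Qed.

Lemma ct_response_trajectory (R : realType) (n m : nat) (A : 'M[R]_n)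
    (B : 'M[R]_(n, m)) (tf : R) u x :
  ct_response A B u x -> ct_trajectory A B tf u x.
Proof.
move=> [uc dx]; split=> [||t _]; last exact: dx.
  by apply: continuous_subspaceT.
by apply: derivable_within_continuous => t _; case: (dx t).
Qed.

(** * The free response *)

Definition egf_coeff (R : realType) (a : nat -> R) (k : nat) : R :=
  a k / k`!%:R.

Lemma pseries_diffs_egf (R : realType) (a : nat -> R) :
  pseries_diffs (egf_coeff a) = egf_coeff (fun k => a k.+1).
Proof.
apply/funext => k; rewrite /pseries_diffs /egf_coeff factS natrM invfM.
by rewrite [a _ * _]mulrC -mulrA mulVKf ?pnatr_eq0 // mulrC.
Qed.

Lemma is_cvg_egf (R : realType) (a : nat -> R) (C M t : R) :
  (forall k, `|a k| <= C * M ^+ k) -> cvgn (pseries (egf_coeff a) t).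
Proof.
move=> aM; apply: normed_cvg.
have cvgE : cvgn (series (C *: exp_coeff (M * `|t|))).
  by apply: is_cvg_seriesZ; exact: is_cvg_series_exp_coeff.
apply: series_le_cvg cvgE => [k|k|k] /=; first exact: normr_ge0.
  rewrite -[leRHS]/(C * exp_coeff (M * `|t|) k) /exp_coeff /= exprMn.
  by rewrite !mulrA mulr_ge0 // mulr_ge0 // (le_trans _ (aM k)).
rewrite -[leRHS]/(C * exp_coeff (M * `|t|) k) /exp_coeff /=.
rewrite exprMn !normrM normrX normfV !mulrA.
rewrite [leRHS]mulrAC normr_nat.
by do 2![apply: ler_wpM2r => //]; exact: aM.
Qed.

(** Differentiating an exponential generating series shifts its coefficients;
    geometric growth survives the shift, which gives the convergence of the
    first and second derived series that term by term differentiation needs. *)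
Lemma is_derive_egf (R : realType) (a : nat -> R) (C M t : R) :
  (forall k, `|a k| <= C * M ^+ k) ->
  is_derive t 1 (fun s => limn (pseries (egf_coeff a) s))
    (limn (pseries (egf_coeff (fun k => a k.+1)) t)).
Proof.
move=> aM; rewrite -pseries_diffs_egf.
have shiftM (b : nat -> R) D :
    (forall k, `|b k| <= D * M ^+ k) ->
    forall k, `|b k.+1| <= (D * M) * M ^+ k.
  by move=> bM k; rewrite -mulrA -exprS.
apply: (@pseries_snd_diffs _ _ (`|t| + 1)); rewrite ?pseries_diffs_egf.
- exact: is_cvg_egf aM.
- exact: (is_cvg_egf (shiftM _ _ aM)).
- exact: (is_cvg_egf (shiftM _ _ (shiftM _ _ aM))).
by rewrite [ltRHS]ger0_norm ?addr_ge0 // ltrDl.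
Qed.

Lemma exp_mulmx_bound (R : realDomainType) (n : nat) (A : 'M[R]_n)
    (v : 'cV[R]_n) (i : 'I_n) (k : nat) :
  `|(A ^+ k *m v) i ord0| <=
  (\sum_j `|v j ord0|) * (\sum_l \sum_j `|A l j|) ^+ k.
Proof.
elim: k i => [|k IH] i.
  rewrite !expr0 mul1mx mulr1 (bigD1 i) //= lerDl; exact: sumr_ge0.
rewrite exprS -mulmxA mxE (le_trans (ler_norm_sum _ _ _)) //.
rewrite exprS mulrCA.
set K := (X in _ <= _ * X).
have K_ge0 : 0 <= K by exact: le_trans (IH i).
apply: (@le_trans _ _ ((\sum_j `|A i j|) * K)).
  by rewrite mulr_suml; apply: ler_sum => j _; rewrite normrM ler_wpM2l.
rewrite ler_wpM2r // [leRHS](bigD1 i) //= lerDl sumr_ge0 // => l _.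
exact: sumr_ge0.
Qed.

(** The state is exp(t A) x0, defined through the scalar series with
    coefficients (A^k x0)_i / k!, so that no convergence of matrix series is
    involved. *)
Lemma free_response (R : realType) (n m : nat) (A : 'M[R]_n)
    (B : 'M[R]_(n, m)) (x0 : 'cV[R]_n) :
  exists2 x, ct_response A B (cst 0) x & x 0 = x0.
Proof.
pose a i k := (A ^+ k *m x0) i ord0.
have aM i k : `|a i k| <= _ := exp_mulmx_bound A x0 i k.
exists (fun t => \col_i limn (pseries (egf_coeff (a i)) t)).
  split=> [t|t]; first exact: cst_continuous.
  apply: is_derive_cV => i; rewrite mulmx0 addr0 mxE.
  under [X in is_derive _ _ X _]funext do rewrite mxE.
  apply: is_derive_eq (is_derive_egf t (aM i)) _.
  under [RHS]eq_bigr do rewrite mxE.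
  apply/cvg_lim => //.
  have -> : pseries (egf_coeff (fun k => a i k.+1)) t =
      (fun N => \sum_j A i j * pseries (egf_coeff (a j)) t N).
    apply/funext => N; rewrite /pseries /series /=.
    under [RHS]eq_bigr do rewrite mulr_sumr.
    rewrite exchange_big /=; apply: eq_bigr => k _.
    rewrite /egf_coeff {1}/a exprS -mulmxA mxE !mulr_suml.
    by apply: eq_bigr => j _; rewrite !mulrA.
  apply: cvg_big => [|j _]; first exact: add_continuous.
  by apply: cvgM; [exact: cvg_cst | exact: is_cvg_egf (aM j)].
apply/matrixP => i j; rewrite mxE [j]ord1; apply/cvg_lim => //.
(* The partial sums at t = 0 are constant from the second one on. *)
rewrite -cvg_shiftS; apply: cvg_near_cst; near=> N.
rewrite /pseries /series /= big_nat_recl //= big1 => [|k _].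
  by rewrite /egf_coeff /a !expr0 mul1mx fact0 divr1 mulr1 addr0.
by rewrite expr0n mulr0.
Unshelve. all: by end_near. Qed.

(** * Polynomial forced responses *)

(** With A^n = \sum_k c_k A^k, the coefficient of A^k B w in the state is
    [flat n c p (n - k.+1)], so that p itself is the coefficient of
    A^(n-1) B w, and the input is [flat n c p n] times w. *)
Fixpoint flat (R : numFieldType) (n : nat) (c : nat -> R) (p : {poly R})
    (i : nat) : {poly R} :=
  if i is k.+1 then (flat n c p k)^`() - c (n - k.+1)%N *: p else p.

(** Each step of the recurrence lowers the order of vanishing at a by exactly
    one: the derivative does, and the correction by a multiple of p still
    vanishes to the full order N. *)
Lemma flat_order (R : numFieldType) (n : nat) (c : nat -> R) (p : {poly R})
    (a : R) (N : nat) (g0 : {poly R}) (i : nat) :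
  p = ('X - a%:P) ^+ N * g0 -> g0.[a] != 0 -> (i <= N)%N ->
  exists2 g, flat n c p i = ('X - a%:P) ^+ (N - i) * g & g.[a] != 0.
Proof.
move=> pE g0a; elim: i => [|i IH] iN; first by exists g0; rewrite ?subn0.
have [g qE ga] := IH (ltnW iN).
have [d [dE NE]] : exists d, (N - i = d.+1 /\ N = d + i.+1)%N.
  by exists (N - i.+1)%N; rewrite subnSK // subnK.
exists (g *+ d.+1 + ('X - a%:P) * g^`()
        - c (n - i.+1)%N *: (('X - a%:P) ^+ i.+1 * g0)).
  rewrite /= qE dE pE NE addnK derivM deriv_exp derivXsubC /= exprD exprS.
  by rewrite mul1r mulrBr mulrDr -!scalerAr mulrnAr mulrnAl mulrCA -!mulrA.
rewrite !hornerE hornerMn subrr /= exprS !(mul0r, mulr0, addr0, subr0).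
by rewrite mulrn_eq0 negb_or.
Qed.

(** In x' - A x the terms telescope: the derivative of the coefficient of A^k
    is the coefficient of A^(k-1) plus c_k p, A shifts the powers by one, and
    the terms c_k p together cancel the overflow p A^n B w.  Only the input
    term, at k = 0, is left. *)
Lemma flat_response (R : realType) (n m : nat) (A : 'M[R]_n)
    (B : 'M[R]_(n, m)) (c : nat -> R) (p : {poly R}) (w : 'cV[R]_m) :
  A ^+ n = \sum_(k < n) c k *: A ^+ k ->
  ct_response A B (fun t => (flat n c p n).[t] *: w)
    (fun t => \sum_(k < n) (flat n c p (n - k.+1)).[t] *: (A ^+ k *m B *m w)).
Proof.
move=> An; pose q := flat n c p; pose V k := A ^+ k *m B *m w.
split=> t.
  by apply: cvgZr_tmp; exact: continuous_horner.
apply: is_derive_cV => i.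
have -> : (fun s => (\sum_(k < n) (q (n - k.+1)%N).[s] *: V k) i ord0) =
    horner (\sum_(k < n) V k i ord0 *: q (n - k.+1)%N).
  apply/funext => s; rewrite summxE horner_sum; apply: eq_bigr => k _.
  by rewrite mxE hornerZ mulrC.
apply: is_derive_eq.
have -> : (\sum_(k < n) V k i ord0 *: q (n - k.+1)%N)^`().[t] =
    (\sum_(k < n) (q (n - k.+1)%N)^`().[t] *: V k) i ord0.
  rewrite summxE raddf_sum horner_sum; apply: eq_bigr => k _.
  by rewrite [RHS]mxE /= derivZ hornerZ mulrC.
congr (_ i ord0).
have VS k : A *m V k = V k.+1 by rewrite /V exprS !mulmxA.
have Vn : V n = \sum_(k < n) c k *: V k.
  by rewrite /V An !mulmx_suml; apply: eq_bigr => k _; rewrite -!scalemxAl.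
have q' (k : 'I_n) :
    (q (n - k.+1)%N)^`().[t] = (q (n - k)%N).[t] + c k * p.[t].
  have -> : q (n - k)%N = (q (n - k.+1)%N)^`() - c k *: p.
    by rewrite -[in LHS](subnSK (ltn_ord k)) /q /= subnSK // subKn // ltnW.
  by rewrite hornerD hornerN hornerZ subrK.
under eq_bigr do rewrite q' scalerDl [c _ * _]mulrC -scalerA.
rewrite big_split /= -scaler_sumr -Vn mulmx_sumr.
under [in RHS]eq_bigr do rewrite -scalemxAr VS.
(* Read p as the n-th term of the telescoping sum. *)
have -> : p.[t] = (q (n - n)%N).[t] by rewrite subnn.
rewrite -(big_ord_recr _ (fun k => (q (n - k)%N).[t] *: V k)) /=.
by rewrite big_ord_recl /= subn0 addrC -scalemxAr /V expr0 mul1mx.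
Qed.

(** * Reachability of the image of the controllability matrix *)

(** Time 1 suffices: in continuous time the set of states reachable from 0 does
    not depend on the horizon. *)
Definition ct_reachable (R : realType) (n m : nat) (A : 'M[R]_n)
    (B : 'M[R]_(n, m)) (y : 'cV[R]_n) : Prop :=
  exists u x, [/\ ct_response A B u x, x 0 = 0 & x 1 = y].

Lemma ct_reachable0 (R : realType) (n m : nat) (A : 'M[R]_n)
    (B : 'M[R]_(n, m)) : ct_reachable A B 0.
Proof.
have [x dx x00] := free_response A B 0.
exists (0 *: cst 0), (0 *: x); split; first exact: ct_responseZ.
  by rewrite -[LHS]/(0 *: x 0) scale0r.
by rewrite -[LHS]/(0 *: x 1) scale0r.
Qed.

Lemma ct_reachableD (R : realType) (n m : nat) (A : 'M[R]_n)
    (B : 'M[R]_(n, m)) (y z : 'cV[R]_n) :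
  ct_reachable A B y -> ct_reachable A B z -> ct_reachable A B (y + z).
Proof.
move=> [u1 [x1 [d1 x10 x11]]] [u2 [x2 [d2 x20 x21]]].
exists (u1 + u2), (x1 + x2); split; first exact: ct_responseD.
  by rewrite -[LHS]/(x1 0 + x2 0) x10 x20 addr0.
by rewrite -[LHS]/(x1 1 + x2 1) x11 x21.
Qed.

Lemma ct_reachableZ (R : realType) (n m : nat) (A : 'M[R]_n)
    (B : 'M[R]_(n, m)) (c : R) (y : 'cV[R]_n) :
  ct_reachable A B y -> ct_reachable A B (c *: y).
Proof.
move=> [u [x [d x0 x1]]]; exists (c *: u), (c *: x).
split; first exact: ct_responseZ.
  by rewrite -[LHS]/(c *: x 0) x0 scaler0.
by rewrite -[LHS]/(c *: x 1) x1.
Qed.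

Lemma ct_reachable_sum (R : realType) (n m : nat) (A : 'M[R]_n)
    (B : 'M[R]_(n, m)) (I : finType) (P : pred I) (y : I -> 'cV[R]_n) :
  (forall i, P i -> ct_reachable A B (y i)) ->
  ct_reachable A B (\sum_(i | P i) y i).
Proof.
move=> yR; apply: (big_ind (ct_reachable A B)) => //.
  exact: ct_reachable0.
by move=> *; exact: ct_reachableD.
Qed.

(** The flat output t^n (t - 1)^j, with j = n - 1 - k.  Its zero of order n at 0
    makes all the coefficients of the state vanish at time 0.  Its zero of order
    exactly j at 1 makes the coefficients of A^l B w vanish at time 1 for l > k
    but not for l = k.  The powers below k are reachable by induction and can
    be subtracted. *)
Lemma ct_reachable_exp (R : realType) (n m : nat) (A : 'M[R]_n)
    (B : 'M[R]_(n, m)) (w : 'cV[R]_m) (k : nat) :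
  (k < n)%N -> ct_reachable A B (A ^+ k *m B *m w).
Proof.
elim/ltn_ind: k => k IH kn; have [c An] := exp_combination A.
pose j := (n - k.+1)%N.
pose p : {poly R} := ('X - 0%:P) ^+ n * ('X - 1%:P) ^+ j.
pose q := flat n c p.
pose y := \sum_(l < n) (q (n - l.+1)%N).[1] *: (A ^+ l *m B *m w).
have q0 i : (i < n)%N -> (q i).[0] = 0.
  move=> i_lt.
  have [||g qE _] :=
    @flat_order _ n c p 0 n (('X - 1%:P) ^+ j) i _ _ (ltnW i_lt) => //.
    by rewrite horner_exp hornerXsubC expf_neq0 // sub0r oppr_eq0 oner_eq0.
  rewrite /q qE hornerM horner_exp hornerXsubC subrr expr0n subn_eq0.
  by rewrite leqNgt i_lt mul0r.
have q1 i : (i <= j)%N -> ((q i).[1] == 0) = (i != j).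
  move=> i_le.
  have [||g qE g1] :=
    @flat_order _ n c p 1 j (('X - 0%:P) ^+ n) i _ _ i_le => //.
  - by rewrite mulrC.
  - by rewrite horner_exp hornerXsubC subr0 expr1n oner_neq0.
  rewrite /q qE hornerM horner_exp hornerXsubC subrr expr0n mulf_eq0.
  rewrite (negPf g1) orbF subn_eq0 eqn_leq i_le /=.
  by case: leqP; rewrite ?eqxx ?oner_eq0.
have yR : ct_reachable A B y.
  exists (fun t => (q n).[t] *: w),
    (fun t => \sum_(l < n) (q (n - l.+1)%N).[t] *: (A ^+ l *m B *m w)).
  split=> //; first exact: flat_response.
  apply: big1 => l _; rewrite q0 ?scale0r // ltn_subrL /=.
  exact: leq_ltn_trans kn.
have yE : y = (q j).[1] *: (A ^+ k *m B *m w) +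
    \sum_(l < n | (l < k)%N) (q (n - l.+1)%N).[1] *: (A ^+ l *m B *m w).
  rewrite /y (bigID (fun l : 'I_n => (l < k)%N)) /= addrC; congr (_ + _).
  rewrite (bigD1 (Ordinal kn)) /= ?ltnn // big1 ?addr0 // => l /andP[].
  rewrite -leqNgt -val_eqE => kl lk.
  have lk' : (k < l)%N by rewrite ltn_neqAle eq_sym lk kl.
  have ij : (n - l.+1 < j)%N by rewrite /j ltn_sub2l // (leq_ltn_trans lk').
  by apply/eqP; rewrite scaler_eq0 q1 ?(ltnW ij) // neq_ltn ij.
have qj : (q j).[1] != 0 by rewrite q1 ?eqxx.
rewrite -[_ *m w](scalerK qj) -[X in _ *: X](addrK
  (\sum_(l < n | (l < k)%N) (q (n - l.+1)%N).[1] *: (A ^+ l *m B *m w))) -yE.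
apply: ct_reachableZ; apply: ct_reachableD => //; rewrite -scaleN1r.
apply: ct_reachableZ; apply: ct_reachable_sum => l lk; apply: ct_reachableZ.
exact: IH.
Qed.

Lemma ct_herdable_of_image (R : realType) (n m : nat) (A : 'M[R]_n)
    (B : 'M[R]_(n, m)) (w : 'cV[R]_(\sum_(k < n) m)) :
  (forall i, 0 < (ctrb A B *m w) i ord0) -> ct_herdable A B.
Proof.
move=> w_gt0 x0 h h_gt0; exists 1; split=> //.
have [u1 [x1 [d1 x10 x11]]] : ct_reachable A B (ctrb A B *m w).
  by rewrite ctrb_mulE; apply: ct_reachable_sum => k _; exact: ct_reachable_exp.
have [x2 d2 x20] := free_response A B x0.
have [c _ c_gt0] := large_multiple (P := predT)
  (fun i => x2 1 i ord0 - h) (fun i _ => w_gt0 i).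
exists (cst 0 + c *: u1), (x2 + c *: x1); split.
- by apply/ct_response_trajectory/ct_responseD => //; exact: ct_responseZ.
- by rewrite -[LHS]/(x2 0 + c *: x1 0) x10 x20 scaler0 addr0.
move=> i; have := c_gt0 i isT.
rewrite -x11 -[(x2 + c *: x1) 1]/(x2 1 + c *: x1 1) !mxE; lra.
Qed.

(** * Herdability *)

Theorem lemma4 (R : realType) (n m : nat) (A : 'M[R]_n) (B : 'M[R]_(n, m))
  (hrow : forall i : 'I_n, row i (ctrb A B) != 0)
  (hsign : forall h : 'I_n, h \notin unisigned_cover (ctrb A B) ->
     exists j : 'I_(\sum_(k < n) m),
       [/\ j \notin unisigned_cols (ctrb A B),
           ctrb A B h j != 0 &
           forall k : 'I_n, k \notin unisigned_cover (ctrb A B) ->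
             ctrb A B k j != 0 ->
             Num.sg (ctrb A B k j) = Num.sg (ctrb A B h j)]) :
  ct_herdable A B /\ dt_herdable A B.
Proof.
have [w w_gt0] : exists w : 'cV[R]_(\sum_(k < n) m),
    forall i, 0 < (ctrb A B *m w) i ord0.
  by apply: image_gt0_of_cover => h /hsign[j [_ hj sgj]]; exists j.
split; first exact: ct_herdable_of_image w_gt0.
exact: dt_herdable_of_image w_gt0.
Qed.
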